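(* Fix a time index $n\ge 1$ and $(\mathbf u_h^{n-1},\xi_h^{n-1},p_h^{n-1})\in \mathbf V_h\times W_h\times M_h$. Let $(\mathbf u_h^n,\xi_h^n,p_h^n)$ be the solution of the $n$-th step of the coupled algorithm, and let $(\mathbf u_h^{n,i},\xi_h^{n,i},p_h^{n,i})_{i\ge 0}$ be the iterates of the iterative decoupled algorithm in the same time step (both defined in the context, with the same previous-step values). Set $e_{\mathbf u}^i=\mathbf u_h^{n,i}-\mathbf u_h^n$, $e_\xi^i=\xi_h^{n,i}-\xi_h^n$, $e_p^i=p_h^{n,i}-p_h^n$. Then for all $i\ge 1$, $$\|e_\xi^i\|_{L^2(\Omega)}\le C\,\|e_\xi^{i-1}\|_{L^2(\Omega)},\qquad C=\frac{\alpha^2/\lambda}{c_0+\alpha^2/\lambda},$$ where $C$ is a positive constant less than or equal to $1$. Moreover, $$\|e_p^i\|_{L^2(\Omega)}\le \frac{C}{\alpha}\,\|e_\xi^{i-1}\|_{L^2(\Omega)},\qquad \|\varepsilon(e_{\mathbf u}^i)\|_{L^2(\Omega)}\le \frac{\sqrt d}{2\mu}\,\|e_\xi^i\|_{L^2(\Omega)}.$$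
   Context: Setting. $\Omega\subset\mathbb R^d$ ($d=2$ or $3$) is a bounded polygonal (polyhedral) domain, with $\partial\Omega=\Gamma_d\cup\Gamma_t=\Gamma_p\cup\Gamma_f$, $|\Gamma_d|>0$, $|\Gamma_p|>0$ ($\Gamma_d,\Gamma_p$ are the Dirichlet parts for displacement and pressure, $\Gamma_t,\Gamma_f$ the Neumann parts). $(\cdot,\cdot)$ is the $L^2(\Omega)$ inner product and $\langle\cdot,\cdot\rangle_\Gamma$ the $L^2(\Gamma)$ inner product; $\varepsilon(\mathbf u)=\frac12(\nabla\mathbf u+(\nabla\mathbf u)^T)$. Parameters: $\mu>0$, $\lambda>0$, $c_0\ge 0$, $\alpha>0$ (Biot–Willis constant), $K>0$ (hydraulic conductivity), time step $\Delta t>0$. Time-independent data: $\mathbf f\in \mathbf L^2(\Omega)$, $\mathbf h\in\mathbf L^2(\Gamma_t)$, $Q_s\in L^2(\Omega)$, $g_2\in L^2(\Gamma_f)$. Finite element spaces on a triangulation $T_h$ of $\Omega$ (Taylor–Hood for $(\mathbf u,\xi)$, $P_1$ for $p$): $\mathbf V_h=\{\mathbf v_h\in \mathbf C^0(\bar\Omega): \mathbf v_h|_{\Gamma_d}=0,\ \mathbf v_h|_\tau\in \mathbf P_2(\tau)\ \forall\tau\in T_h\}$, $W_h=\{\phi_h\in C^0(\bar\Omega):\phi_h|_\tau\in P_1(\tau)\ \forall \tau\in T_h\}$, $M_h=\{\psi_h\in C^0(\bar\Omega):\psi_h|_{\Gamma_p}=0,\ \psi_h|_\tau\in P_1(\tau)\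 \forall\tau\in T_h\}$. Coupled algorithm, $n$-th step: given $(\mathbf u_h^{n-1},\xi_h^{n-1},p_h^{n-1})$, find $(\mathbf u_h^n,\xi_h^n,p_h^n)\in\mathbf V_h\times W_h\times M_h$ such that for all $(\mathbf v_h,\phi_h,\psi_h)\in \mathbf V_h\times W_h\times M_h$: $$2\mu(\varepsilon(\mathbf u_h^n),\varepsilon(\mathbf v_h))-(\xi_h^n,\operatorname{div}\mathbf v_h)=(\mathbf f,\mathbf v_h)+\langle\mathbf h,\mathbf v_h\rangle_{\Gamma_t},$$ $$(\operatorname{div}\mathbf u_h^n,\phi_h)+\tfrac1\lambda(\xi_h^n,\phi_h)-\tfrac\alpha\lambda(p_h^n,\phi_h)=0,$$ $$(c_0+\tfrac{\alpha^2}\lambda)(p_h^n,\psi_h)-\tfrac\alpha\lambda(\xi_h^n,\psi_h)+K\Delta t(\nabla p_h^n,\nabla\psi_h)=\Delta t(Q_s,\psi_h)+\Delta t\langle g_2,\psi_h\rangle_{\Gamma_f}+(c_0+\tfrac{\alpha^2}\lambda)(p_h^{n-1},\psi_h)-\tfrac\alpha\lambda(\xi_h^{n-1},\psi_h).$$ Iterative decoupled algorithm in time step $n$: initialize $\mathbf u_h^{n,0}=\mathbf u_h^{n-1}$, $\xi_h^{n,0}=\xi_h^{n-1}$, $p_h^{n,0}=p_h^{n-1}$. For $i\ge 1$: Step 1: given $\xi_h^{n,i-1}\in W_h$, find $p_h^{n,i}\in M_h$ such that for all $\psi_h\in M_h$ $$(c_0+\tfrac{\alpha^2}\lambda)(p_h^{n,i},\psi_h)+K\Delta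 t(\nabla p_h^{n,i},\nabla\psi_h)=(c_0+\tfrac{\alpha^2}\lambda)(p_h^{n-1},\psi_h)+\tfrac\alpha\lambda(\xi_h^{n,i-1}-\xi_h^{n-1},\psi_h)+\Delta t(Q_s,\psi_h)+\Delta t\langle g_2,\psi_h\rangle_{\Gamma_f}.$$ Step 2: given $p_h^{n,i}$, find $(\mathbf u_h^{n,i},\xi_h^{n,i})\in\mathbf V_h\times W_h$ such that for all $(\mathbf v_h,\phi_h)\in\mathbf V_h\times W_h$ $$2\mu(\varepsilon(\mathbf u_h^{n,i}),\varepsilon(\mathbf v_h))-(\xi_h^{n,i},\operatorname{div}\mathbf v_h)=(\mathbf f,\mathbf v_h)+\langle\mathbf h,\mathbf v_h\rangle_{\Gamma_t},\qquad (\operatorname{div}\mathbf u_h^{n,i},\phi_h)+\tfrac1\lambda(\xi_h^{n,i},\phi_h)=\tfrac\alpha\lambda(p_h^{n,i},\phi_h).$$ *)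

(* Defs.v *)
From HB Require Import structures.
From mathcomp Require Import all_boot all_order all_algebra.
From mathcomp Require Import -(notations) mpoly.
From mathcomp Require Import all_classical all_reals all_analysis.
From mathcomp Require Import measurable_realfun.

Set Implicit Arguments.
Unset Strict Implicit.
Unset Printing Implicit Defensive.

Import Order.TTheory GRing.Theory Num.Theory.
Import numFieldNormedType.Exports.

Local Open Scope classical_set_scope.
Local Open Scope ring_scope.

(* The sigma-algebra generated by the coordinates, i.e. the Borel one. *)
Definition rV_display : measure_display. Proof. exact. Qed.

Section measurable_rV.
Context (R : realType) (n : nat).

Definition coord_rV (i : 'I_n) (x : 'rV[R]_n) : measurableTypeR R := x ord0 i.

Let rV_set0 : g_sigma_preimage coord_rV set0.
Proof. exact: sigma_algebra0. Qed.

Let rV_setC A : g_sigma_preimage coord_rV A -> g_sigma_preimage coord_rV (~` A).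
Proof. exact: sigma_algebraC. Qed.

Let rV_bigcup (F : (set 'rV[R]_n)^nat) :
  (forall i, g_sigma_preimage coord_rV (F i)) ->
  g_sigma_preimage coord_rV (\bigcup_i (F i)).
Proof. exact: sigma_algebra_bigcup. Qed.

HB.instance Definition _ := @isMeasurable.Build rV_display 'rV[R]_n
  (g_sigma_preimage coord_rV) rV_set0 rV_setC rV_bigcup.

Lemma measurable_coord_rV (i : 'I_n) : measurable_fun setT (coord_rV i).
Proof.
move=> _ Y mY; rewrite setTI; apply: sub_sigma_algebra => /=.
rewrite -bigcup_seq/=; exists i => /=; first by rewrite mem_index_enum.
by exists Y => //; rewrite setTI.
Qed.

Lemma measurable_fun_rVP d (T : measurableType d) (f : T -> 'rV[R]_n) :
  (forall i, measurable_fun setT (coord_rV i \o f)) -> measurable_fun setT f.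
Proof.
move=> mf; apply: (@measurability _ _ _ _ setT f
  (\big[setU/set0]_(i < n) preimage_set_system setT (coord_rV i) measurable)).
  by [].
move=> _ [B + <-]; rewrite -bigcup_seq/= => -[i _ [A mA <-]].
by rewrite setTI; exact: mf.
Qed.

End measurable_rV.

Section lebesgue_rV.
Context (R : realType).

Definition cons_rV n (z : measurableTypeR R * 'rV[R]_n) : 'rV[R]_n.+1 :=
  \row_i oapp (fun j => z.2 ord0 j) z.1 (unlift ord0 i).

Lemma measurable_cons_rV n : measurable_fun setT (@cons_rV n).
Proof.
apply: measurable_fun_rVP => i.
case: (unliftP ord0 i) => [j|] ->.
  rewrite (_ : _ \o _ = (@coord_rV R n j) \o snd); last first.
    by apply/funext => z; rewrite /coord_rV /cons_rV /= mxE liftK.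
  by apply: measurableT_comp; first exact: measurable_coord_rV.
rewrite (_ : _ \o _ = fst); last first.
  by apply/funext => z; rewrite /coord_rV /cons_rV /= mxE unlift_none.
exact: measurable_fst.
Qed.

Definition uncons_rV n (x : 'rV[R]_n.+1) : measurableTypeR R * 'rV[R]_n :=
  (x ord0 ord0, \row_j x ord0 (lift ord0 j)).

Lemma cons_rVK n : cancel (@cons_rV n) (@uncons_rV n).
Proof.
move=> -[a b]; rewrite /uncons_rV /cons_rV mxE unlift_none /=; congr pair.
by apply/rowP => j; rewrite !mxE liftK.
Qed.

Lemma measurable_uncons_rV n : measurable_fun setT (@uncons_rV n).
Proof.
apply/measurable_fun_pairP; split.
  exact: (@measurable_coord_rV R n.+1 ord0).
apply: measurable_fun_rVP => j.
rewrite (_ : _ \o _ = @coord_rV R n.+1 (lift ord0 j)).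
  exact: measurable_coord_rV.
by apply/funext => x; rewrite /coord_rV /= mxE.
Qed.

Section step.
Variables (n : nat) (m : {sigma_finite_measure set 'rV[R]_n -> \bar R}).

Definition lebesgue_rVS : set 'rV[R]_n.+1 -> \bar R :=
  pushforward (lebesgue_measure \x m)%E (@cons_rV n).

Let push : {measure set 'rV[R]_n.+1 -> \bar R} :=
  measure_function_pushforward__canonical__measure_function_Measure
    (product_measure1 lebesgue_measure m) (@measurable_cons_rV n).

HB.instance Definition _ := isMeasure.Build _ _ _ lebesgue_rVS
  (measure0 push) (measure_ge0 push) (@measure_semi_sigma_additive _ _ _ push).

Let lebesgue_rVS_sigma_finite : sigma_finite setT lebesgue_rVS.
Proof.
have /sigma_finiteP[F [FT ndF Foo]] := sigma_finiteT (@lebesgue_measure R).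
have /sigma_finiteP[G [GT ndG Goo]] := sigma_finiteT m.
exists (fun k => @uncons_rV n @^-1` (F k `*` G k)).
  apply/seteqP; split => // x _ /=.
  have [a _ Fa] : (\bigcup_i F i) (uncons_rV x).1 by rewrite -FT.
  have [b _ Gb] : (\bigcup_i G i) (uncons_rV x).2 by rewrite -GT.
  exists (maxn a b) => //; split => /=.
    by move: Fa; apply/subsetPset/ndF/leq_maxl.
  by move: Gb; apply/subsetPset/ndG/leq_maxr.
move=> k; have [mF Fk] := Foo k; have [mG Gk] := Goo k; split.
  rewrite -[X in measurable X]setTI.
  by apply: measurable_uncons_rV => //; exact: measurableX.
have -> : lebesgue_rVS (@uncons_rV n @^-1` (F k `*` G k)) =
    ((@lebesgue_measure R) \x m)%E (F k `*` G k).
  rewrite /lebesgue_rVS /pushforward; congr (product_measure1 _ _ _).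
  by apply/funext => z; rewrite /preimage /mkset cons_rVK.
rewrite product_measure1E//.
by rewrite lte_mul_pinfty// ge0_fin_numE.
Qed.

HB.instance Definition _ := Measure_isSigmaFinite.Build _ _ _ lebesgue_rVS
  lebesgue_rVS_sigma_finite.

End step.

Let dirac0 : {sigma_finite_measure set 'rV[R]_0 -> \bar R} := \d_(0 : 'rV[R]_0).

Fixpoint lebesgue_rV (n : nat) : {sigma_finite_measure set 'rV[R]_n -> \bar R} :=
  match n with
  | 0 => dirac0
  | n'.+1 => lebesgue_rVS (lebesgue_rV n')
  end.

Lemma measurable_box n (A : 'I_n -> set (measurableTypeR R)) :
  (forall i, measurable (A i)) ->
  measurable [set x : 'rV[R]_n | forall i, A i (x ord0 i)].
Proof.
move=> mA; rewrite (_ : mkset _ =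
    \bigcap_(i in [set: 'I_n]) (coord_rV i @^-1` A i)).
  apply: fin_bigcap_measurable; first exact: finite_finset.
  move=> i _; rewrite -[X in measurable X]setTI.
  exact: measurable_coord_rV.
by apply/seteqP; split => [x Ax i _|x Ax i]; [exact: Ax|exact: (Ax i I)].
Qed.

Lemma lebesgue_rV_box n (A : 'I_n -> set (measurableTypeR R)) :
  (forall i, measurable (A i)) ->
  lebesgue_rV n [set x | forall i, A i (x ord0 i)] =
  (\prod_(i < n) lebesgue_measure (A i))%E.
Proof.
elim: n A => [|n IH] A mA.
  rewrite big_ord0 /= diracE mem_set//= => -[] //.
rewrite big_ord_recl -IH//.
have mB := measurable_box (fun j => mA (lift ord0 j)).
rewrite -(product_measure1E lebesgue_measure (lebesgue_rV n))//.
rewrite /= /lebesgue_rVS /pushforward; congr (product_measure1 _ _ _).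
apply/seteqP; split => -[a b] /=.
  move=> Aab; split=> [|j]; first by have := Aab ord0; rewrite mxE unlift_none.
  by have := Aab (lift ord0 j); rewrite mxE liftK.
move=> [Aa Ab] i; rewrite mxE.
by case: (unliftP ord0 i) => [j|] -> /=.
Qed.

End lebesgue_rV.

(* A simplicial mesh is given by its nodes and, for each element, the set of
   (the indices of) its vertices. *)
Record mesh (R : realType) (d : nat) := Mesh {
  nb_nodes : nat;
  node : 'I_nb_nodes -> 'rV[R]_d;
  cells : {set {set 'I_nb_nodes}}
}.

Section mesh_geometry.
Context (R : realType) (d : nat) (T : mesh R d).
Implicit Types S F : {set 'I_(nb_nodes T)}.

Definition closed_simplex S : set 'rV[R]_d :=
  [set x | exists t : 'I_(nb_nodes T) -> R,
    [/\ forall i, i \in S -> 0 <= t i,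
        \sum_(i in S) t i = 1 &
        x = \sum_(i in S) t i *: node i] ].

Definition affinely_independent S : Prop :=
  forall t : 'I_(nb_nodes T) -> R,
    \sum_(i in S) t i = 0 -> \sum_(i in S) t i *: node i = 0 ->
    forall i, i \in S -> t i = 0.

Definition triangulates (Omega : set 'rV[R]_d) : Prop :=
  [/\ forall S, S \in cells T -> #|S| = d.+1 /\ affinely_independent S,
      forall S S', S \in cells T -> S' \in cells T ->
        closed_simplex S `&` closed_simplex S' = closed_simplex (S :&: S') &
      closure Omega = \bigcup_(S in [set S | S \in cells T]) closed_simplex S].

(* The (d-1)-faces belonging to exactly one element; their union is the
   boundary of the triangulated domain. *)
Definition boundary_faces : {set {set 'I_(nb_nodes T)}} :=
  [set F : {set 'I_(nb_nodes T)} |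
    (#|F| == d) && (#|[set S in cells T | F \subset S]| == 1%N)]%SET.

(* Affine parametrization of the face F by the reference simplex. *)
Definition face_node F (k : nat) : 'rV[R]_d :=
  nth 0 [seq node i | i <- enum F] k.

Definition face_jacobian F : 'M[R]_(d.-1, d) :=
  \matrix_(k, j) (face_node F k.+1 - face_node F 0) ord0 j.

Definition face_param F (s : 'rV[R]_d.-1) : 'rV[R]_d :=
  face_node F 0 + s *m face_jacobian F.

Definition ref_simplex n : set 'rV[R]_n :=
  [set s | (forall i, 0 <= s ord0 i) /\ \sum_i s ord0 i <= 1].

Lemma measurable_ref_simplex n : measurable (@ref_simplex n).
Proof.
rewrite (_ : @ref_simplex n =
  (\bigcap_(i in [set: 'I_n]) coord_rV i @^-1` `[0, +oo[) `&`
  (fun s : 'rV[R]_n => \sum_i coord_rV i s) @^-1` `]-oo, 1]).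
  apply: measurableI.
    apply: fin_bigcap_measurable; first exact: finite_finset.
    move=> i _; rewrite -[X in measurable X]setTI.
    exact: measurable_coord_rV.
  rewrite -[X in measurable X]setTI.
  apply: (_ : measurable_fun setT (fun s : 'rV[R]_n => \sum_i coord_rV i s)) => //.
  by apply: measurable_sum => i; exact: measurable_coord_rV.
apply/seteqP; split => s /=; rewrite in_itv/=.
  by move=> [s0 s1]; split => // i _ /=; rewrite in_itv/= s0.
by move=> [s0 s1]; split => // i; have := s0 i I; rewrite /= in_itv/= andbT.
Qed.

Lemma measurable_face_param F : measurable_fun setT (face_param F).
Proof.
apply: measurable_fun_rVP => j.
rewrite (_ : _ \o _ = fun s => face_node F 0 ord0 j +
    \sum_k coord_rV k s * face_jacobian F k j).
  apply: measurable_funD => //; apply: measurable_sum => k.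
  by apply: measurable_funM => //; exact: measurable_coord_rV.
by apply/funext => s; rewrite /coord_rV /face_param /= mxE [in LHS]mxE.
Qed.

Definition ref_measure : {measure set 'rV[R]_d.-1 -> \bar R} :=
  mrestr (lebesgue_rV R d.-1) (@measurable_ref_simplex d.-1).

Definition gram_face F : R :=
  Num.sqrt (\det (face_jacobian F *m (face_jacobian F)^T)).

Lemma gram_face_ge0 F : 0 <= gram_face F. Proof. exact: sqrtr_ge0. Qed.

Definition face_measure F : {measure set 'rV[R]_d -> \bar R} :=
  mscale (NngNum (gram_face_ge0 F))
    (measure_function_pushforward__canonical__measure_function_Measure
      ref_measure (@measurable_face_param F)).

Definition surface_measure : {measure set 'rV[R]_d -> \bar R} :=
  msum (fun k => face_measure (nth finset.set0 (enum boundary_faces) k))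
    #|boundary_faces|.

Lemma surface_measureE (A : set 'rV[R]_d) :
  surface_measure A = (\sum_(F in boundary_faces) (gram_face F)%:E *
    lebesgue_rV R d.-1 (face_param F @^-1` A `&` @ref_simplex d.-1))%E.
Proof.
rewrite -big_enum /= (big_nth finset.set0) -cardE.
by rewrite big_mkord.
Qed.

End mesh_geometry.

Section L2.
Context (R : realType) (d : nat).
Variable m : {measure set 'rV[R]_d -> \bar R}.
Implicit Types (D : set 'rV[R]_d).

Definition frob p q (A B : 'M[R]_(p, q)) : R := \sum_i \sum_j A i j * B i j.

Definition ip D (f g : 'rV[R]_d -> R) : R := \int[m]_(x in D) (f x * g x).

Definition ipM D p q (f g : 'rV[R]_d -> 'M[R]_(p, q)) : R :=
  \int[m]_(x in D) frob (f x) (g x).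

Definition L2norm D (f : 'rV[R]_d -> R) : R := Num.sqrt (ip D f f).

Definition L2normM D p q (f : 'rV[R]_d -> 'M[R]_(p, q)) : R :=
  Num.sqrt (ipM D f f).

End L2.

Definition L2 (R : realType) (d : nat) (m : {measure set 'rV[R]_d -> \bar R})
    (D : set 'rV[R]_d) (f : 'rV[R]_d -> R) : Prop :=
  measurable_fun D f /\ m.-integrable D (fun x => (f x ^+ 2)%:E).

(* Classical derivatives: for functions that are smooth on each element they
   exist off the skeleton of the mesh, a Lebesgue-null set, and represent the
   weak derivatives. *)
Section derivatives.
Context (R : realType) (d : nat).

Definition grad (f : 'rV[R]_d -> R) (x : 'rV[R]_d) : 'rV[R]_d :=
  \row_j 'D_(delta_mx ord0 j) f x.

Definition gradv (u : 'rV[R]_d -> 'rV[R]_d) (x : 'rV[R]_d) : 'M[R]_d :=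
  \matrix_(i, j) grad (fun y => u y ord0 i) x ord0 j.

Definition strain (u : 'rV[R]_d -> 'rV[R]_d) (x : 'rV[R]_d) : 'M[R]_d :=
  2^-1 *: (gradv u x + (gradv u x)^T).

Definition div (u : 'rV[R]_d -> 'rV[R]_d) (x : 'rV[R]_d) : R := \tr (gradv u x).

End derivatives.

Record biot_data (R : realType) (d : nat) := BiotData {
  Omega : set 'rV[R]_d;
  Gamma_d : set 'rV[R]_d;
  Gamma_t : set 'rV[R]_d;
  Gamma_p : set 'rV[R]_d;
  Gamma_f : set 'rV[R]_d;
  Th : mesh R d;
  bmu : R;
  blambda : R;
  bc0 : R;
  balpha : R;
  bK : R;
  bdt : R;
  bf : 'rV[R]_d -> 'rV[R]_d;
  bh : 'rV[R]_d -> 'rV[R]_d;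
  bQs : 'rV[R]_d -> R;
  bg2 : 'rV[R]_d -> R
}.

(* The fields u, xi and p only matter on the closure of Omega. *)
Record state (R : realType) (d : nat) := State {
  su : 'rV[R]_d -> 'rV[R]_d;
  sxi : 'rV[R]_d -> R;
  sp : 'rV[R]_d -> R
}.

Section biot.
Context (R : realType) (d : nat) (B : biot_data R d).
Implicit Types (X Y prev : state R d).

Local Notation Omega := (Omega B).
Local Notation mu := (bmu B).
Local Notation lambda := (blambda B).
Local Notation c0 := (bc0 B).
Local Notation alpha := (balpha B).
Local Notation K := (bK B).
Local Notation dt := (bdt B).
Local Notation sigma := (surface_measure (Th B)).
Local Notation "( f , g )_O" := (ip (lebesgue_rV R d) Omega f g)
  (format "( f ,  g )_O").
Local Notation "( f , g )_MO" := (ipM (lebesgue_rV R d) Omega f g)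
  (format "( f ,  g )_MO").

Definition boundary : set 'rV[R]_d := closure Omega `\` interior Omega.

(* Polygonality of the domain is part of [triangulates]; the condition on the
   interior of the closure excludes slits and other removed null sets. *)
Record biot_setting : Prop := BiotSetting {
  dim23 : d = 2%N \/ d = 3%N;
  Omega_neq0 : Omega !=set0;
  Omega_bounded : bounded_set Omega;
  Omega_open : open Omega;
  Omega_connected : connected Omega;
  Omega_regular : interior (closure Omega) = Omega;
  Th_triangulates : triangulates (Th B) Omega;
  Gamma_d_measurable : measurable (Gamma_d B);
  Gamma_t_measurable : measurable (Gamma_t B);
  Gamma_p_measurable : measurable (Gamma_p B);
  Gamma_f_measurable : measurable (Gamma_f B);
  Gamma_dt : boundary = Gamma_d B `|` Gamma_t B;
  Gamma_pf : boundary = Gamma_p B `|` Gamma_f B;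
  Gamma_d_gt0 : (0 < sigma (Gamma_d B))%E;
  Gamma_p_gt0 : (0 < sigma (Gamma_p B))%E;
  mu_gt0 : 0 < mu;
  lambda_gt0 : 0 < lambda;
  c0_ge0 : 0 <= c0;
  alpha_gt0 : 0 < alpha;
  K_gt0 : 0 < K;
  dt_gt0 : 0 < dt;
  f_L2 : forall i, L2 (lebesgue_rV R d) Omega (fun x => bf B x ord0 i);
  h_L2 : forall i, L2 sigma (Gamma_t B) (fun x => bh B x ord0 i);
  Qs_L2 : L2 (lebesgue_rV R d) Omega (bQs B);
  g2_L2 : L2 sigma (Gamma_f B) (bg2 B)
}.

(* Continuous piecewise polynomials of total degree at most k. *)
Definition Pk_fe (k : nat) (f : 'rV[R]_d -> R) : Prop :=
  {within closure Omega, continuous f} /\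
  forall S, S \in cells (Th B) ->
    exists2 q : mpoly d R, (msize q <= k.+1)%N &
      forall x, closed_simplex S x -> f x = meval (x ord0) q.

Definition Vh (v : 'rV[R]_d -> 'rV[R]_d) : Prop :=
  (forall i, Pk_fe 2 (fun x => v x ord0 i)) /\
  (forall x, Gamma_d B x -> v x = 0).

Definition Wh (phi : 'rV[R]_d -> R) : Prop := Pk_fe 1 phi.

Definition Mh (psi : 'rV[R]_d -> R) : Prop :=
  Pk_fe 1 psi /\ (forall x, Gamma_p B x -> psi x = 0).

Definition in_spaces X : Prop := [/\ Vh (su X), Wh (sxi X) & Mh (sp X)].

Definition coupled_step prev X : Prop :=
  in_spaces X /\
  forall v phi psi, Vh v -> Wh phi -> Mh psi ->
  [/\ 2 * mu * (strain (su X), strain v)_MO - (sxi X, div v)_O =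
        (bf B, v)_MO + ipM sigma (Gamma_t B) (bh B) v,
      (div (su X), phi)_O + 1 / lambda * (sxi X, phi)_O
        - alpha / lambda * (sp X, phi)_O = 0 &
      (c0 + alpha ^+ 2 / lambda) * (sp X, psi)_O
        - alpha / lambda * (sxi X, psi)_O
        + K * dt * (grad (sp X), grad psi)_MO =
      dt * (bQs B, psi)_O + dt * ip sigma (Gamma_f B) (bg2 B) psi
        + (c0 + alpha ^+ 2 / lambda) * (sp prev, psi)_O
        - alpha / lambda * (sxi prev, psi)_O].

(* One iteration, computing Y from the previous iterate X; prev is the state
   at the previous time step. *)
Definition decoupled_step prev X Y : Prop :=
  [/\ in_spaces Y,
      forall psi, Mh psi ->
        (c0 + alpha ^+ 2 / lambda) * (sp Y, psi)_O
          + K * dt * (grad (sp Y), grad psi)_MO =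
        (c0 + alpha ^+ 2 / lambda) * (sp prev, psi)_O
          + alpha / lambda * ((fun x => sxi X x - sxi prev x), psi)_O
          + dt * (bQs B, psi)_O + dt * ip sigma (Gamma_f B) (bg2 B) psi &
      forall v phi, Vh v -> Wh phi ->
        2 * mu * (strain (su Y), strain v)_MO - (sxi Y, div v)_O =
          (bf B, v)_MO + ipM sigma (Gamma_t B) (bh B) v /\
        (div (su Y), phi)_O + 1 / lambda * (sxi Y, phi)_O =
          alpha / lambda * (sp Y, phi)_O].

Definition decoupled_iterates prev (Y : nat -> state R d) : Prop :=
  (forall x, closure Omega x ->
    [/\ su (Y 0%N) x = su prev x, sxi (Y 0%N) x = sxi prev x &
        sp (Y 0%N) x = sp prev x]) /\
  (forall i, (1 <= i)%N -> decoupled_step prev (Y i.-1) (Y i)).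

End biot.

(* Main.v *)
(* Testing the difference of the two flow equations with e_p and dropping the
   gradient term gives (c0 + alpha^2/lambda) |e_p|^2 <=
   (alpha/lambda) (e_xi^{i-1}, e_p). Testing the differences of the elasticity
   and pressure equations with e_u and e_xi gives
   2 mu |eps(e_u)|^2 = (e_xi, div e_u) and
   (e_xi, div e_u) + |e_xi|^2 / lambda = (alpha/lambda) (e_p, e_xi), whence
   |e_xi| <= alpha |e_p|; the bound on eps(e_u) follows from
   div e_u = tr eps(e_u).

   The forms are only bilinear once integrands are known to be integrable, and
   classical derivatives take arbitrary values on the skeleton of the mesh. Each
   closed simplex is an intersection of d+1 half-spaces (barycentric
   coordinates), so it differs from an open set by a subset of finitely many
   hyperplanes, which are Lebesgue-null; on these open sets every finite element
   function and every partial derivative of it is a polynomial. *)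

Require Import Defs.
From mathcomp Require Import all_boot all_order all_algebra.
From mathcomp Require Import -(notations) mpoly.
From mathcomp Require Import all_classical all_reals all_analysis.
From mathcomp Require Import measurable_realfun.
From mathcomp Require Import ring lra.
Import Order.TTheory GRing.Theory Num.Theory.
Import numFieldNormedType.Exports.

Set Implicit Arguments.
Unset Strict Implicit.
Unset Printing Implicit Defensive.

Local Open Scope classical_set_scope.
Local Open Scope ring_scope.

(** * Null sets and simplices *)

(* The function need not be measurable: the integral is a supremum over the
   simple functions below it, and these can be set to 0 on the null set. *)
Section integral_off_null_set.
Local Open Scope ereal_scope.
Context d (T : measurableType d) (R : realType) (m : {measure set T -> \bar R}).
Implicit Types (D E : set T).

Import HBNNSimple.

Lemma ge0_integral_off_null D E (f : T -> \bar R) : (forall x, 0 <= f x) ->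
  E `<=` D -> m.-negligible (D `\` E) ->
  \int[m]_(x in D) f x = \int[m]_(x in E) f x.
Proof.
move=> f0 ED [N [mN N0 DEN]].
have fD0 A x : 0 <= (f \_ A) x by rewrite patchE; case: ifP.
rewrite integral_mkcond [RHS]integral_mkcond !ge0_integralTE//.
apply/eqP; rewrite eq_le; apply/andP; split; last first.
  apply: ereal_sup_le => _ [h hf <-]; exists h => // x.
  apply: le_trans (hf x) _; rewrite !patchE; case: ifPn => [xE|_].
    by rewrite mem_set//; apply: ED; exact: set_mem.
  by case: ifP.
apply: ge_ereal_sup => _ [h hf <-].
have mNC : measurable (~` N) by exact: measurableC.
(* The cut-off of [h] to the complement of [N] agrees with [h] almost everywhere, so the simple
   integral is unchanged. *)
rewrite (_ : sintegral m h = sintegral m (proj_nnsfun h mNC)); last first.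
  have sintE (g : {nnsfun T >-> R}) : sintegral m g = \int[m]_x (g x)%:E.
    by rewrite integral_nnsfun// patch_setT.
  rewrite !sintE; apply: ge0_ae_eq_integral => //.
  - exact/measurable_EFinP.
  - exact/measurable_EFinP.
  - by move=> x _; rewrite lee_fin.
  - by move=> x _; rewrite lee_fin.
  exists N; split => // x /=; apply: contra_notP => xN _ /=.
  by rewrite /mindic indicE mem_set// mulr1.
apply: ereal_sup_ubound; exists (proj_nnsfun h mNC) => // x /=.
rewrite /mindic indicE; have [xN|xN] := boolP (x \in ~` N); last first.
  by rewrite mulr0 fD0.
rewrite mulr1; apply: le_trans (hf x) _; rewrite !patchE.
case: ifPn => [/set_mem Dx|_]; last by case: ifP.
rewrite ifT//; apply/mem_set; apply: contrapT => Ex.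
by move/set_mem: xN; apply; exact: DEN.
Qed.

Lemma integral_off_null D E (f : T -> \bar R) :
  E `<=` D -> m.-negligible (D `\` E) ->
  \int[m]_(x in D) f x = \int[m]_(x in E) f x.
Proof.
move=> ED DE; rewrite integralE [RHS]integralE.
by congr (_ - _); apply: ge0_integral_off_null.
Qed.

Lemma Rintegral_off_null D E (f : T -> R) :
  E `<=` D -> m.-negligible (D `\` E) ->
  (\int[m]_(x in D) f x = \int[m]_(x in E) f x)%R.
Proof. by move=> ED DE; rewrite /Rintegral (integral_off_null _ ED). Qed.

End integral_off_null_set.

(** Codes turn the union into a sequence: [G n] gathers the indices of code [n], at most one since
    [pickle] is injective, so it is empty or some [F i]. *)
Lemma negligible_countable_bigcup d (T : measurableType d) (R : realType)
    (m : {measure set T -> \bar R}) (I : countType) (D : set I)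
    (F : I -> set T) :
  (forall i, D i -> m.-negligible (F i)) ->
  m.-negligible (\bigcup_(i in D) F i).
Proof.
move=> F0; pose G n := \bigcup_(i in D `&` [set i | pickle i = n]) F i.
apply: (@negligibleS _ _ _ _ (\bigcup_n G n)).
  by move=> x [i Di Fix]; exists (pickle i) => //; exists i.
apply: negligible_bigcup => n; rewrite /G.
have [[i [Di ni]]|noi] := pselect (exists i, D i /\ pickle i = n).
  rewrite (_ : _ `&` _ = [set i]) ?bigcup_set1; first exact: F0.
  apply/seteqP; split => [j [_ /= nj]|j ->//].
  by apply: (pcan_inj pickleK); rewrite nj.
rewrite (_ : _ `&` _ = set0) ?bigcup_set0; first exact: negligible_set0.
by rewrite -subset0 => i Di; apply: noi; exists i.
Qed.

(** * Affine functions and hyperplanes *)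

Section affine.
Context (R : realType) (d : nat).
Implicit Types (c : R) (a : 'cV[R]_d).

Definition affine c a (x : 'rV[R]_d) : R := c + (x *m a) ord0 ord0.

Lemma affineE c a x : affine c a x = c + \sum_i x ord0 i * a i ord0.
Proof. by rewrite /affine mxE. Qed.

Lemma measurable_affine c a : measurable_fun setT (affine c a).
Proof.
rewrite (_ : affine c a = fun x => c + \sum_i coord_rV i x * a i ord0).
  apply: measurable_funD => //; apply: measurable_sum => i.
  by apply: measurable_funM => //; exact: measurable_coord_rV.
by apply/funext => x; rewrite affineE.
Qed.

Lemma continuous_affine c a : continuous (affine c a).
Proof.
rewrite (_ : affine c a = fun x => c + \sum_i x ord0 i * a i ord0); last first.
  by apply/funext => y; rewrite affineE.
have sum_cont : continuous (fun x : 'rV[R]_d => \sum_i x ord0 i * a i ord0).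
  apply: (@continuous_big R^o 'I_d +%R 0 xpredT); first exact: add_continuous.
  move=> i _ y; apply: continuousM; first exact: coord_continuous.
  exact: cst_continuous.
by move=> x; apply: continuousD; [exact: cst_continuous|exact: sum_cont].
Qed.

End affine.

(** Fubini and induction on the dimension: the slice over a first coordinate [z] is the zero set of
    [affine (c + z * a0) a'], degenerate for at most one [z]. Admitting [a = 0] with [c != 0] (an
    empty zero set) makes the hypothesis stable under slicing. *)
Lemma lebesgue_rV_hyperplane (R : realType) (d : nat) (c : R) (a : 'cV[R]_d) :
  c != 0 \/ a != 0 ->
  lebesgue_rV R d [set x | affine c a x = 0] = 0%E.
Proof.
elim: d c a => [|d IH] c a ca.
  rewrite (_ : mkset _ = set0) ?measure0//.
  rewrite -subset0 => x /=; rewrite affineE big_ord0 addr0 => c0.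
  by case: ca => /eqP; [|by rewrite flatmx0].
pose a0 := a ord0 ord0; pose a' : 'cV_d := \col_j a (lift ord0 j) ord0.
rewrite (_ : lebesgue_rV _ _ _ = \int[@lebesgue_measure R]_z lebesgue_rV R d
  (xsection (@cons_rV R d @^-1` [set x | affine c a x = 0%R]) z))%E//.
(* The excluded value solves [c + z * a0 = 0]; for [a0 = 0] the quotient is 0 by convention, and
   removing that point is harmless. *)
rewrite (@integral_off_null _ _ _ (@lebesgue_measure R) _
    (~` [set (- c / a0 : measurableTypeR R)]))//; last first.
  exists [set - c / a0]; split => //; first exact: lebesgue_measure_set1.
  by move=> x [_ /contrapT].
rewrite integral0_eq// => z /= za.
have affS y : affine c a (cons_rV (z, y)) = affine (c + z * a0) a' y.
  rewrite !affineE big_ord_recl /cons_rV !mxE unlift_none /= addrA.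
  by congr (_ + _); apply: eq_bigr => i _; rewrite !mxE liftK.
rewrite (_ : xsection _ z = [set y | affine (c + z * a0) a' y = 0]); last first.
  by apply/seteqP; split => y; rewrite /xsection /= in_setE /= affS.
apply: IH; have [a'0|] := eqVneq a' 0; [left|by right].
have [a00|a00] := eqVneq a0 0.
  rewrite a00 mulr0 addr0; case: ca => // /eqP a_neq0.
  exfalso; apply: a_neq0; apply/matrixP => i j; rewrite !ord1 mxE.
  case: (unliftP ord0 i) => [k|] -> //.
  by have /colP/(_ k) := a'0; rewrite !mxE.
rewrite addrC addr_eq0; apply/negP => /eqP cz; apply: za; apply: (mulIf a00).
by rewrite divfK.
Qed.

(** * Simplices as intersections of half-spaces *)

Section simplex.
Context (R : realType) (d : nat) (T : mesh R d).
Implicit Types S : {set 'I_(nb_nodes T)}.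

(* The half-spaces are given by the barycentric coordinates, read off the
   (invertible) matrix whose rows are the vertices prefixed by 1. *)
Lemma closed_simplex_half_spaces S : #|S| = d.+1 -> affinely_independent S ->
  exists (c : 'I_#|S| -> R) (a : 'I_#|S| -> 'cV[R]_d),
    (forall k, c k != 0 \/ a k != 0) /\
    closed_simplex S = [set x | forall k, 0 <= affine (c k) (a k) x].
Proof.
move=> cardS indS.
pose M : 'M[R]_(#|S|, 1 + d) := \matrix_k row_mx (const_mx 1) (node (enum_val k)).
have rowM (v : 'rV_#|S|) : v *m M = row_mx (const_mx (\sum_k v ord0 k))
    (\sum_k v ord0 k *: node (enum_val k)).
  rewrite mulmx_sum_row; apply/rowP => j; rewrite summxE.
  case: (split_ordP j) => k ->.
    rewrite row_mxEl mxE; apply: eq_bigr => i _.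
    by rewrite mxE [row _ _ _ _]mxE [M _ _]mxE row_mxEl mxE mulr1.
  rewrite row_mxEr summxE; apply: eq_bigr => i _.
  by rewrite mxE [row _ _ _ _]mxE [M _ _]mxE row_mxEr [RHS]mxE.
(* Carries coefficients indexed by the enumeration of [S] to a function on all nodes, zero off
   [S]. *)
pose ext (v : 'rV[R]_#|S|) i : R := \sum_(k | enum_val k == i) v ord0 k.
have extE v k : ext v (enum_val k) = v ord0 k.
  rewrite /ext (big_pred1 k)// => l.
  by rewrite /= (inj_eq enum_val_inj).
have sum_ext v : \sum_(i in S) ext v i = \sum_k v ord0 k.
  by rewrite big_enum_val /=; apply: eq_bigr => k _; rewrite extE.
have sumZ_ext v : \sum_(i in S) ext v i *: node i =
    \sum_k v ord0 k *: node (enum_val k).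
  by rewrite big_enum_val /=; apply: eq_bigr => k _; rewrite extE.
have freeM : row_free M.
  apply: inj_row_free => v; rewrite rowM -row_mx0 => /eq_row_mx[v1 vx].
  apply/rowP => k; rewrite mxE -extE; apply: indS; last exact: enum_valP.
    by rewrite sum_ext; move/rowP : v1 => /(_ ord0); rewrite !mxE.
  by rewrite sumZ_ext vx.
(* [M] has as many rows as columns, so [P] below is a two-sided inverse: [M P = 1] serves the
   inclusion of the simplex in the half-spaces, [P M = 1] the converse. *)
have fullM : row_full M by rewrite /row_full (eqP freeM) cardS.
pose P := pinvmx M.
exists (fun k => P (lshift d ord0) k), (fun k => \col_j P (rshift 1 j) k).
split=> [k|].
  (* If both coefficients vanished, column [k] of [P] would be zero, against the diagonal entry 1 of
     [M P]. *)
  have [c0|] := eqVneq (P (lshift d ord0) k) 0; [right|by left].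
  apply/eqP => a0; have /matrixP/(_ k k) := mulmxVp freeM.
  rewrite mxE big_split_ord /= big_ord1 c0 mulr0 add0r big1 => [|j _].
    by rewrite mxE eqxx => /eqP; rewrite eq_sym oner_eq0.
  by have /colP/(_ j) := a0; rewrite !mxE => ->; rewrite mulr0.
have affP x k : affine (P (lshift d ord0) k) (\col_j P (rshift 1 j) k) x =
    (row_mx (const_mx 1) x *m P) ord0 k.
  rewrite affineE [RHS]mxE big_split_ord /= big_ord1 row_mxEl [const_mx _ _ _]mxE mul1r.
  by congr (_ + _); apply: eq_bigr => j _; rewrite row_mxEr mxE.
apply/seteqP; split => x.
  move=> [t [t0 t1 ->]] k; rewrite affP.
  rewrite (_ : row_mx _ _ = (\row_k t (enum_val k)) *m M).
    by rewrite -mulmxA mulmxVp// mulmx1 mxE t0// enum_valP.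
  rewrite rowM; congr row_mx.
    congr const_mx; rewrite -t1 big_enum_val.
    by apply: eq_bigr => i _; rewrite mxE.
  by rewrite big_enum_val; apply: eq_bigr => i _; rewrite mxE.
move=> x0; pose v := row_mx (const_mx 1) x *m P.
have : v *m M = row_mx (const_mx 1) x by rewrite -mulmxA mulVpmx// mulmx1.
rewrite rowM => /eq_row_mx[v1 vx]; exists (ext v); split.
- move=> i iS; rewrite -(enum_rankK_in iS iS) extE.
  by have := x0 (enum_rank_in iS i); rewrite /= affP.
- by rewrite sum_ext; move/rowP : v1 => /(_ ord0); rewrite !mxE.
- by rewrite sumZ_ext vx.
Qed.

(** [U] is cut out by the strict barycentric inequalities. Openness and measurability are separate
    claims, as the sigma-algebra is generated by the coordinates. *)
Lemma closed_simplex_open_part S : #|S| = d.+1 -> affinely_independent S ->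
  exists U : set 'rV[R]_d, [/\ open U, measurable U, U `<=` closed_simplex S &
    (lebesgue_rV R d).-negligible (closed_simplex S `\` U)].
Proof.
move=> cardS indS; have [c [a [ca ->]]] := closed_simplex_half_spaces cardS indS.
exists [set x | forall k, 0 < affine (c k) (a k) x]; split.
- rewrite openE => x /= x0.
  apply: (@filter_forall _ _ (fun k y => 0 < affine (c k) (a k) y) (nbhs x)) => k.
  exact: (cvgr_gt _ (@continuous_affine _ _ (c k) (a k) x)).
- rewrite (_ : mkset _ = \bigcap_(k in [set: 'I_#|S|])
      affine (c k) (a k) @^-1` `]0, +oo[).
    apply: fin_bigcap_measurable; first exact: finite_finset.
    by move=> k _; rewrite -[X in measurable X]setTI; exact: measurable_affine.
  apply/seteqP; split => x /= x0 k; first by rewrite /= in_itv/= x0.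
  by have := x0 k I; rewrite /= in_itv/= andbT.
- by move=> x x0 k; exact/ltW.
- apply: (@negligibleS _ _ _ _
      (\bigcup_(k in [set: 'I_#|S|]) [set x | affine (c k) (a k) x = 0])).
    move=> x [x0 /existsNP[k /negP]]; rewrite -leNgt => xk.
    by exists k => //; apply/eqP; rewrite eq_le xk x0.
  apply: negligible_countable_bigcup => k _.
  exists [set x | affine (c k) (a k) x = 0]; split => //.
    rewrite (_ : mkset _ = affine (c k) (a k) @^-1` [set 0])//.
    by rewrite -[X in measurable X]setTI; exact: measurable_affine.
  exact: lebesgue_rV_hyperplane.
Qed.

End simplex.

(** * Piecewise polynomials *)

Section polynomial_functions.
Context (R : realType) (d : nat).
Implicit Types (q : mpoly d R) (x : 'rV[R]_d).

(** Constants and variables generate the polynomials as a ring, so facts about evaluation can be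
    checked on these and carried through sums and products. *)
Lemma mpoly_ring_ind (P : mpoly d R -> Prop) :
  (forall c, P (mpolyC d c)) -> (forall i, P (mpolyX R (mnm1 i))) ->
  (forall p q, P p -> P q -> P (p + q)) ->
  (forall p q, P p -> P q -> P (p * q)) -> forall p, P p.
Proof.
move=> PC PX PD PM; elim/mpolyind => [|c m p _ _ Pp]; first exact: (PC 0).
apply: (PD) => //; rewrite -mul_mpolyC; apply: (PM) => //.
rewrite mpolyXE_id; apply: big_ind => [|//|i _]; first exact: (PC 1).
elim: (m i) => [|k Pk]; first exact: (PC 1).
by rewrite exprS; exact: PM.
Qed.

Lemma measurable_meval q :
  measurable_fun setT (fun x => meval (x ord0) q : measurableTypeR R).
Proof.
elim/mpoly_ring_ind: q => [c|i|p q mp mq|p q mp mq].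
- by under eq_fun do rewrite mevalC; exact: measurable_cst.
- by under eq_fun do rewrite mevalXU; exact: measurable_coord_rV.
- by under eq_fun do rewrite mevalD; exact: measurable_funD.
- by under eq_fun do rewrite mevalM; exact: measurable_funM.
Qed.

Lemma bounded_meval q (r : R) :
  exists M, forall x, (forall i, `|x ord0 i| <= r) -> `|meval (x ord0) q| <= M.
Proof.
elim/mpoly_ring_ind: q => [c|i|p q [M pM] [N qN]|p q [M pM] [N qN]].
- by exists `|c| => x _; rewrite mevalC.
- by exists r => x xr; rewrite mevalXU.
- exists (M + N) => x xr; rewrite mevalD (le_trans (ler_normD _ _))//.
  by rewrite lerD ?pM ?qN.
- exists (M * N) => x xr; rewrite mevalM normrM.
  by rewrite ler_pM ?pM ?qN.
Qed.

Lemma is_derive_coord (i j : 'I_d) x :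
  is_derive x (delta_mx ord0 j) (fun y : 'rV[R]_d => y ord0 i) (i == j)%:R.
Proof.
set f := fun y : 'rV[R]_d => y ord0 i.
have fcvg : h^-1 *: (f (h *: delta_mx ord0 j + x) - f x) @[h --> 0^'] -->
    ((i == j)%:R : R).
  apply: cvg_near_cst; near=> h.
  rewrite /f !mxE eqxx /= addrK /GRing.scale /= mulrA mulVf ?mul1r//.
  by near: h; exact: nbhs_dnbhs_neq.
split; first by apply/cvg_ex; exists (i == j)%:R.
exact: (cvg_lim _ fcvg).
Unshelve. all: by end_near. Qed.

Lemma is_derive_meval q (j : 'I_d) x :
  is_derive x (delta_mx ord0 j) (fun y : 'rV[R]_d => meval (y ord0) q)
    (meval (x ord0) (mderiv j q)).
Proof.
elim/mpoly_ring_ind: q x => [c|i|p q dp dq|p q dp dq] x.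
- under eq_fun do rewrite mevalC.
  by rewrite mderivC meval0; exact: is_derive_cst.
- under eq_fun do rewrite mevalXU.
  rewrite mderivX mevalZ mnm1E.
  have [<-|ij] := eqVneq i j; last first.
    by rewrite mul0r; apply: (is_derive_eq (is_derive_coord i j x)); rewrite (negbTE ij).
  apply: (is_derive_eq (is_derive_coord i i x)).
  (* The remaining monomial has exponent zero and evaluates to 1. *)
  by rewrite eqxx mevalX big1 ?mulr1// => k _; rewrite mnmBE subnn.
- under eq_fun do rewrite mevalD.
  by rewrite mderivD mevalD; exact: is_deriveD.
- under eq_fun do rewrite mevalM.
  rewrite mderivM mevalD !mevalM.
  apply: (is_derive_eq (is_deriveM (dp x) (dq x))).
  by rewrite /GRing.scale /=; ring.
Qed.

End polynomial_functions.

(** * Derivatives of piecewise polynomials *)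

Section piecewise_polynomials.
Context (R : realType) (d : nat) (T : mesh R d) (D : set 'rV[R]_d).
Context (U : {set 'I_(nb_nodes T)} -> set 'rV[R]_d).

Let G := \bigcup_(S in [set S | S \in cells T]) U S.

(** Separates the geometry of the mesh from the analysis: openness serves derivatives, measurability
    and the null remainder serve integrals. *)
Record cell_interiors : Prop := CellInteriors {
  ci_open : forall S, S \in cells T -> open (U S);
  ci_measurable : forall S, S \in cells T -> measurable (U S);
  ci_simplex : forall S, S \in cells T -> U S `<=` closed_simplex S;
  ci_sub : forall S, S \in cells T -> U S `<=` D;
  ci_null : (lebesgue_rV R d).-negligible (D `\` G)
}.

(** With no continuity or degree bound imposed, the class is closed under products and coordinate
    derivatives. *)
Definition piecewise_poly (f : 'rV[R]_d -> R) : Prop :=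
  forall S, S \in cells T ->
    exists q : mpoly d R, forall x, U S x -> f x = meval (x ord0) q.

Definition piecewise_polyv (u : 'rV[R]_d -> 'rV[R]_d) : Prop :=
  forall i, piecewise_poly (fun x => u x ord0 i).

Lemma piecewise_polyD f g : piecewise_poly f -> piecewise_poly g ->
  piecewise_poly (fun x => f x + g x).
Proof.
move=> pf pg S ST; have [[p fp] [q gq]] := (pf S ST, pg S ST).
by exists (p + q) => x Ux; rewrite mevalD fp// gq.
Qed.

Lemma piecewise_polyM f g : piecewise_poly f -> piecewise_poly g ->
  piecewise_poly (fun x => f x * g x).
Proof.
move=> pf pg S ST; have [[p fp] [q gq]] := (pf S ST, pg S ST).
by exists (p * q) => x Ux; rewrite mevalM fp// gq.
Qed.

Lemma piecewise_poly_cst c : piecewise_poly (fun=> c).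
Proof. by move=> S ST; exists (mpolyC d c) => x _; rewrite mevalC. Qed.

Lemma piecewise_polyZ c f : piecewise_poly f ->
  piecewise_poly (fun x => c * f x).
Proof. by move=> pf; apply: piecewise_polyM => //; exact: piecewise_poly_cst. Qed.

Lemma piecewise_polyB f g : piecewise_poly f -> piecewise_poly g ->
  piecewise_poly (fun x => f x - g x).
Proof.
move=> pf pg; under eq_fun do rewrite -mulN1r.
by apply: piecewise_polyD => //; exact: piecewise_polyZ.
Qed.

Lemma piecewise_poly_sum (I : Type) (r : seq I) (f : I -> 'rV[R]_d -> R) :
  (forall i, piecewise_poly (f i)) ->
  piecewise_poly (fun x => \sum_(i <- r) f i x).
Proof.
move=> pf; elim: r => [|i r IH].
  by under eq_fun do rewrite big_nil; exact: piecewise_poly_cst.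
by under eq_fun do rewrite big_cons; exact: piecewise_polyD.
Qed.

Hypothesis UG : cell_interiors.

(** A derivative depends only on the germ of the function, and the open set [U S] is a neighbourhood
    of [x]. *)
Let is_derive_meval_on f j S q x : S \in cells T ->
  (forall y, U S y -> f y = meval (y ord0) q) -> U S x ->
  is_derive x (delta_mx ord0 j) f (meval (x ord0) (mderiv j q)).
Proof.
move=> ST fq Ux; apply: near_eq_is_derive (is_derive_meval q j x).
have : nbhs x (U S) by apply: open_nbhs_nbhs; split => //; exact: (ci_open UG).
by apply: filterS => y Uy; rewrite fq.
Qed.

Lemma piecewise_poly_derivable f j x : piecewise_poly f -> G x ->
  derivable f x (delta_mx ord0 j).
Proof.
move=> pf [S ST Ux]; have [q fq] := pf S ST.
by have [] := is_derive_meval_on j ST fq Ux.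
Qed.

Lemma piecewise_poly_grad f j : piecewise_poly f ->
  piecewise_poly (fun x => grad f x ord0 j).
Proof.
move=> pf S ST; have [q fq] := pf S ST; exists (mderiv j q) => x Ux.
by rewrite mxE; have [_ ->] := is_derive_meval_on j ST fq Ux.
Qed.

Lemma strainE (u : 'rV[R]_d -> 'rV[R]_d) x i j : strain u x i j =
  2^-1 * (grad (fun y => u y ord0 i) x ord0 j + grad (fun y => u y ord0 j) x ord0 i).
Proof. by rewrite /strain /gradv /trmx !mxE. Qed.

Lemma piecewise_poly_strain u i j : piecewise_polyv u ->
  piecewise_poly (fun x => strain u x i j).
Proof.
move=> pu; under eq_fun do rewrite strainE.
apply: piecewise_polyZ; apply: piecewise_polyD; exact: piecewise_poly_grad.
Qed.

(** Stated on [G], where both classical derivatives are known to exist. *)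
Lemma gradB f g x : piecewise_poly f -> piecewise_poly g -> G x ->
  grad (fun y => f y - g y) x = grad f x - grad g x.
Proof.
move=> pf pg Gx; apply/rowP => j; rewrite !mxE.
by apply: deriveB; exact: piecewise_poly_derivable.
Qed.

Lemma gradvB u v x : piecewise_polyv u ->
  piecewise_polyv v -> G x ->
  gradv (fun y => u y - v y) x = gradv u x - gradv v x.
Proof.
move=> pu pv Gx; apply/matrixP => i j; rewrite [LHS]mxE.
rewrite (_ : (fun y => _) = (fun y => u y ord0 i - v y ord0 i)); last first.
  by apply/funext => y; rewrite !mxE.
by rewrite gradB// !mxE.
Qed.

Lemma strainB u v x : piecewise_polyv u ->
  piecewise_polyv v -> G x ->
  strain (fun y => u y - v y) x = strain u x - strain v x.
Proof.
move=> pu pv Gx; rewrite /strain gradvB// -scalerBr; congr (_ *: _).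
by rewrite linearB /= opprD addrACA.
Qed.

Lemma div_strain (u : 'rV[R]_d -> 'rV[R]_d) x :
  div u x = \sum_i strain u x i i.
Proof.
by apply: eq_bigr => i _; rewrite strainE mxE; lra.
Qed.

Lemma piecewise_poly_div u : piecewise_polyv u ->
  piecewise_poly (div u).
Proof.
move=> pu; rewrite (_ : div u = fun x => \sum_i strain u x i i).
  by apply: piecewise_poly_sum => i; exact: piecewise_poly_strain.
by apply/funext => x; rewrite div_strain.
Qed.

Lemma divB u v x : piecewise_polyv u ->
  piecewise_polyv v -> G x ->
  div (fun y => u y - v y) x = div u x - div v x.
Proof. by move=> pu pv Gx; rewrite /div gradvB// linearB. Qed.

(** * Integrability on the cell interiors *)

Let measurableG : measurable G.
Proof.
apply: fin_bigcup_measurable; first exact: finite_finset.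
by move=> S ST; exact: (ci_measurable UG).
Qed.

Lemma measurable_piecewise_poly f : piecewise_poly f ->
  measurable_fun G (f : 'rV[R]_d -> measurableTypeR R).
Proof.
move=> pf _ Y mY; rewrite setI_bigcupl.
apply: fin_bigcup_measurable; first exact: finite_finset.
move=> S ST; have [q fq] := pf S ST.
rewrite (_ : _ `&` _ = U S `&` (fun x => meval (x ord0) q) @^-1` Y).
  apply: measurableI; first exact: (ci_measurable UG).
  by rewrite -[X in measurable X]setTI; exact: measurable_meval.
by apply/seteqP; split => x [Ux]; rewrite /= fq.
Qed.

Hypothesis bndD : bounded_set D.

Let bounded_coord : exists r : R, forall x, D x -> forall i, `|x ord0 i| <= r.
Proof.
have [M [_ DM]] := bndD; exists (M + 1) => x Dx i.
apply: le_trans (DM (M + 1) _ x Dx); last by rewrite ltrDl.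
by rewrite [leRHS]/Num.norm /= mx_normrE; apply/bigmax_geP; right; exists (ord0, i).
Qed.

Let subG : G `<=` D.
Proof. by move=> x [S ST Ux]; exact: (ci_sub UG) Ux. Qed.

(** Boundedness of [D] puts [G] inside a box, whose measure is a finite product of interval
    lengths. *)
Let finG : (lebesgue_rV R d G < +oo)%E.
Proof.
have [r Dr] := bounded_coord.
pose A (i : 'I_d) : set (measurableTypeR R) := `[- r, r]%classic.
have mA i : measurable (A i) by exact: measurable_itv.
have /le_lt_trans : (lebesgue_rV R d G <= lebesgue_rV R d
    [set x | forall i, A i (x ord0 i)])%E.
  apply: le_measure; rewrite ?inE//; first exact: measurable_box.
  by move=> x /subG Dx i; rewrite /A /= in_itv/= -ler_norml Dr.
apply.
rewrite (lebesgue_rV_box mA) ltey_eq prode_fin_num// => i _.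
by rewrite /A lebesgue_measure_itv/=; case: ifP.
Qed.

Lemma integrable_piecewise_poly f : piecewise_poly f ->
  (lebesgue_rV R d).-integrable G (EFin \o f).
Proof.
move=> pf; apply: measurable_bounded_integrable => //.
  exact: measurable_piecewise_poly.
have [r Dr] := bounded_coord.
have /choice[M fM] S : exists M : R, S \in cells T -> forall x, U S x -> `|f x| <= M.
  have [ST|] := boolP (S \in cells T); last by exists 0.
  have [q fq] := pf S ST; have [M qM] := bounded_meval q r.
  exists M => _ x Ux; rewrite fq// qM// => i; apply: Dr.
  exact: (ci_sub UG) Ux.
(* A uniform bound over the finitely many cells; the absolute values make the sum dominate each
   [M S]. *)
exists (\sum_S `|M S|); split; first exact: num_real.
move=> N /ltW MN x [S ST Ux]; apply: le_trans MN.
rewrite (bigD1 S)//= (le_trans (fM S ST x Ux))//.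
by rewrite (le_trans (ler_norm _))// lerDl sumr_ge0.
Qed.

Notation I f := (\int[lebesgue_rV R d]_(x in D) f x).

(** Each integral rule below passes through [G]: there the integrands are integrable and derivatives
    split pointwise, while their values on the null remainder of [D] are uncontrolled. *)
Let IG f : I f = \int[lebesgue_rV R d]_(x in G) f x.
Proof. by apply: Rintegral_off_null => //; exact: (ci_null UG). Qed.

Let eqI f g : (forall x, G x -> f x = g x) -> I f = I g.
Proof.
by move=> fg; rewrite !IG; apply: eq_Rintegral => x /set_mem; exact: fg.
Qed.

Let leI f g : piecewise_poly f -> piecewise_poly g ->
  (forall x, G x -> f x <= g x) -> I f <= I g.
Proof.
move=> pf pg fg; rewrite !IG; apply: le_Rintegral => //;
  exact: integrable_piecewise_poly.
Qed.

Let ID f g : piecewise_poly f -> piecewise_poly g ->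
  I (fun x => f x + g x) = I f + I g.
Proof.
by move=> pf pg; rewrite !IG; apply: RintegralD => //;
  exact: integrable_piecewise_poly.
Qed.

Let IB f g : piecewise_poly f -> piecewise_poly g ->
  I (fun x => f x - g x) = I f - I g.
Proof.
by move=> pf pg; rewrite !IG; apply: RintegralB => //;
  exact: integrable_piecewise_poly.
Qed.

Let IZ c f : piecewise_poly f -> I (fun x => c * f x) = c * I f.
Proof.
by move=> pf; rewrite !IG; apply: RintegralZl => //;
  exact: integrable_piecewise_poly.
Qed.

(** * Bilinear forms and norm estimates *)

Notation mu := (lebesgue_rV R d).

Lemma ipBl f g h : piecewise_poly f -> piecewise_poly g -> piecewise_poly h ->
  ip mu D (fun x => f x - g x) h = ip mu D f h - ip mu D g h.
Proof.
move=> pf pg ph; rewrite /ip -IB; try exact: piecewise_polyM.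
by apply: eqI => x _; rewrite mulrBl.
Qed.

Lemma piecewise_poly_frob p q (A B : 'rV[R]_d -> 'M[R]_(p, q)) :
  (forall i j, piecewise_poly (fun x => A x i j)) ->
  (forall i j, piecewise_poly (fun x => B x i j)) ->
  piecewise_poly (fun x => frob (A x) (B x)).
Proof.
move=> pA pB; do 2 (apply: piecewise_poly_sum => ?).
exact: piecewise_polyM.
Qed.

(** [E] stands for the gradient or strain of a difference, which is known to split only on [G]. *)
Lemma ipMBl p q (A B C E : 'rV[R]_d -> 'M[R]_(p, q)) :
  (forall i j, piecewise_poly (fun x => A x i j)) ->
  (forall i j, piecewise_poly (fun x => B x i j)) ->
  (forall i j, piecewise_poly (fun x => C x i j)) ->
  (forall x, G x -> E x = A x - B x) ->
  ipM mu D E C = ipM mu D A C - ipM mu D B C.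
Proof.
move=> pA pB pC EAB; rewrite /ipM -IB; try exact: piecewise_poly_frob.
apply: eqI => x Gx; rewrite EAB// /frob -sumrB; apply: eq_bigr => i _.
by rewrite -sumrB; apply: eq_bigr => j _; rewrite !mxE mulrBl.
Qed.

Lemma ipM_gradBl f g h :
  piecewise_poly f -> piecewise_poly g -> piecewise_poly h ->
  ipM mu D (grad (fun x => f x - g x)) (grad h) =
  ipM mu D (grad f) (grad h) - ipM mu D (grad g) (grad h).
Proof.
move=> pf pg ph.
apply: ipMBl => [i j|i j|i j|x Gx]; rewrite ?ord1; try exact: piecewise_poly_grad.
exact: gradB.
Qed.

Lemma ipM_strainBl u v w :
  piecewise_polyv u -> piecewise_polyv v -> piecewise_polyv w ->
  ipM mu D (strain (fun x => u x - v x)) (strain w) =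
  ipM mu D (strain u) (strain w) - ipM mu D (strain v) (strain w).
Proof.
move=> pu pv pw.
apply: ipMBl => [i j|i j|i j|x Gx]; try exact: piecewise_poly_strain.
exact: strainB.
Qed.

Lemma ip_divBl u v h :
  piecewise_polyv u -> piecewise_polyv v -> piecewise_poly h ->
  ip mu D (div (fun x => u x - v x)) h = ip mu D (div u) h - ip mu D (div v) h.
Proof.
move=> pu pv ph; rewrite -ipBl; try exact: piecewise_poly_div; last by [].
by apply: eqI => x Gx; rewrite divB.
Qed.

Lemma ipC f g : ip mu D f g = ip mu D g f.
Proof. by congr (fine _); apply: eq_integral => x _; rewrite mulrC. Qed.

Lemma ipM_ge0 p q (A : 'rV[R]_d -> 'M[R]_(p, q)) : 0 <= ipM mu D A A.
Proof.
apply: Rintegral_ge0 => x _; apply: sumr_ge0 => i _; apply: sumr_ge0 => j _.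
by rewrite -expr2 sqr_ge0.
Qed.

(** Young's inequality replaces Cauchy-Schwarz, avoiding a division by the norm of [g]: integrate
    [(k f - a g)^2 >= 0], bound the cross term below by the hypothesis times [2 a], and absorb one
    [a^2 |g|^2]. *)
Lemma L2norm_le_of_ip f g (a k : R) : piecewise_poly f -> piecewise_poly g ->
  0 < a -> 0 <= k -> a * ip mu D g g <= k * ip mu D f g ->
  L2norm mu D g <= k / a * L2norm mu D f.
Proof.
move=> pf pg a0 k0 agkf.
have pff := piecewise_polyM pf pf; have pgg := piecewise_polyM pg pg.
have pfg := piecewise_polyM pf pg.
have young : 2 * k * a * ip mu D f g <= k ^+ 2 * ip mu D f f + a ^+ 2 * ip mu D g g.
  rewrite -!IZ// -ID; try exact: piecewise_polyZ.
  apply: leI => [||x _]; first exact: piecewise_polyZ.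
    by apply: piecewise_polyD; exact: piecewise_polyZ.
  by have := sqr_ge0 (k * f x - a * g x); lra.
have {young agkf} gf : a ^+ 2 * ip mu D g g <= k ^+ 2 * ip mu D f f.
  have := ler_wpM2l (ltW a0) agkf; lra.
have ka0 : 0 <= k / a by rewrite divr_ge0// ltW.
rewrite /L2norm -(ger0_norm ka0) -sqrtr_sqr -sqrtrM ?sqr_ge0//.
rewrite ler_wsqrtr// expr_div_n mulrAC ler_pdivlMr ?exprn_gt0//.
by rewrite mulrC.
Qed.

(** In [f * eps_ii <= f^2 / (4 a) + a * eps_ii^2] the weight is chosen so that half of the left-hand
    energy absorbs the strain term; the [d] diagonal entries of the divergence give the factor
    [sqrt d]. *)
Lemma L2normM_strain_le u f (a : R) : piecewise_polyv u -> piecewise_poly f ->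
  0 < a -> 2 * a * ipM mu D (strain u) (strain u) <= ip mu D f (div u) ->
  L2normM mu D (strain u) <= Num.sqrt d%:R / (2 * a) * L2norm mu D f.
Proof.
move=> pu pf a0 uf.
have pff := piecewise_polyM pf pf.
have puu : piecewise_poly (fun x => frob (strain u x) (strain u x)).
  by apply: piecewise_poly_frob => i j; exact: piecewise_poly_strain.
have a40 : 0 < 4 * a by rewrite mulr_gt0.
(* Young's inequality on each diagonal entry of the strain. *)
have young : ip mu D f (div u) <=
    d%:R / (4 * a) * ip mu D f f + a * ipM mu D (strain u) (strain u).
  rewrite -!IZ// -ID; try exact: piecewise_polyZ.
  apply: leI => [||x _].
  - by apply: piecewise_polyM => //; exact: piecewise_poly_div.
  - by apply: piecewise_polyD; exact: piecewise_polyZ.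
  rewrite div_strain mulr_sumr.
  apply: (@le_trans _ _ (\sum_(i < d) ((4 * a)^-1 * (f x * f x) +
      a * (strain u x i i * strain u x i i)))).
    apply: ler_sum => i _; rewrite -(ler_pM2l a40) mulrDr.
    rewrite [X in _ <= X + _]mulrA divff ?gt_eqF// mul1r.
    by have := sqr_ge0 (f x - 2 * a * strain u x i i); lra.
  rewrite big_split /= sumr_const card_ord -[X in X + _]mulr_natl.
  rewrite [X in X + _ <= _]mulrA lerD2l.
  (* The diagonal squares are completed to the Frobenius norm by the nonnegative off-diagonal
     ones. *)
  rewrite -mulr_sumr ler_wpM2l ?(ltW a0)//; apply: ler_sum => i _.
  rewrite (bigD1 i)//= lerDl sumr_ge0// => j _.
  by rewrite -expr2 sqr_ge0.
have {young uf} le4 : a * ipM mu D (strain u) (strain u) <=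
  d%:R / (4 * a) * ip mu D f f by lra.
have da0 : 0 <= Num.sqrt d%:R / (2 * a).
  by rewrite divr_ge0 ?sqrtr_ge0// mulr_ge0// ltW.
rewrite /L2normM /L2norm -(ger0_norm da0) -sqrtr_sqr -sqrtrM ?sqr_ge0//.
rewrite ler_wsqrtr// expr_div_n sqr_sqrtr ?ler0n//.
rewrite -(ler_pM2l a0); apply: (le_trans le4).
rewrite le_eqVlt; apply/orP; left; apply/eqP.
by field; rewrite gt_eqF.
Qed.

End piecewise_polynomials.

(** * Error equations *)

Section finite_element_spaces.
Context (R : realType) (d : nat) (B : biot_data R d).

Lemma cell_interiors_exist : interior (closure (Omega B)) = Omega B ->
  triangulates (Th B) (Omega B) -> exists U, cell_interiors (T := Th B) (Omega B) U.
Proof.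
move=> regO [cellT _ closO].
have /choice[U cellU] S : exists U : set 'rV[R]_d, S \in cells (Th B) ->
    [/\ open U, measurable U, U `<=` closed_simplex S &
    (lebesgue_rV R d).-negligible (closed_simplex S `\` U)].
  have [ST|] := boolP (S \in cells (Th B)); last by exists set0.
  have [cardS indS] := cellT S ST.
  by have [V VS] := closed_simplex_open_part cardS indS; exists V.
exists U; split => [S|S|S|S ST|]; try by move=> /cellU[].
(* The open set [U S] lies in the closure of [Omega], hence in the interior of that closure, which
   is [Omega] by regularity. *)
- have [oU _ US _] := cellU S ST; rewrite -regO.
  by rewrite -open_subsetE// => x /US Sx; rewrite closO; exists S.
- apply: (@negligibleS _ _ _ _ (\bigcup_(S in [set S | S \in cells (Th B)])
    (closed_simplex S `\` U S))).
    move=> x [/subset_closure]; rewrite closO => -[S ST Sx] nUx.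
    by exists S => //; split => // Ux; apply: nUx; exists S.
  by apply: negligible_countable_bigcup => S /cellU[].
Qed.

Lemma Pk_fe_piecewise_poly (U : {set 'I_(nb_nodes (Th B))} -> set 'rV[R]_d) k f :
  cell_interiors (Omega B) U -> Pk_fe B k f -> piecewise_poly U f.
Proof.
move=> UG [_ fe] S ST; have [q _ fq] := fe S ST.
by exists q => x Ux; apply: fq; exact: (ci_simplex UG) Ux.
Qed.

Lemma Pk_feB k f g : Pk_fe B k f -> Pk_fe B k g ->
  Pk_fe B k (fun x => f x - g x).
Proof.
move=> [cf pf] [cg pg]; split.
  by move=> x; apply: continuousB; [exact: cf|exact: cg].
move=> S ST; have [[p sp fp] [q sq gq]] := (pf S ST, pg S ST).
exists (p - q); last by move=> x Sx; rewrite mevalB fp// gq.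
by rewrite (leq_trans (msizeD_le _ _))// msizeN geq_max sp.
Qed.

Lemma VhB u v : Vh B u -> Vh B v -> Vh B (fun x => u x - v x).
Proof.
move=> [pu u0] [pv v0]; split => [i|x Gx]; last by rewrite u0// v0// subrr.
by under eq_fun do rewrite !mxE; exact: Pk_feB.
Qed.

Lemma MhB p q : Mh B p -> Mh B q -> Mh B (fun x => p x - q x).
Proof.
move=> [pp p0] [pq q0]; split => [|x Gx]; first exact: Pk_feB.
by rewrite p0// q0// subrr.
Qed.

End finite_element_spaces.

(* Generalizing the forms keeps [lra] from comparing them up to conversion. *)
Ltac generalize_ip :=
  repeat match goal with
  | |- context [ip ?m ?D ?f ?g] => generalize (ip m D f g)
  | |- context [ipM ?m ?D ?f ?g] => generalize (ipM m D f g)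
  end.

(** * One iteration from [Y] to [Z], compared with the coupled solution [X] *)

Section error_equations.
Context (R : realType) (d : nat) (B : biot_data R d) (hB : biot_setting B).
Context (prev X Y Z : state R d).
Hypotheses (hprev : in_spaces B prev) (hX : coupled_step B prev X).
Hypothesis hZ : decoupled_step B prev Y Z.

Notation m := (lebesgue_rV R d).
Notation e_u := (fun x => su Z x - su X x).
Notation e_xi := (fun x => sxi Z x - sxi X x).
Notation e_p := (fun x => sp Z x - sp X x).

Context (U : {set 'I_(nb_nodes (Th B))} -> set 'rV[R]_d).
Hypothesis UG : cell_interiors (Omega B) U.
Hypothesis pY : piecewise_poly U (sxi Y).

Let bndO := Omega_bounded hB.
Let pp k f := @Pk_fe_piecewise_poly _ _ _ _ k f UG.

(** Data and previous-step terms cancel on subtraction. The coupled equation has its own [xi] where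
    the iteration has the lagged one, so the right-hand side carries the error of [Y]. *)
Lemma error_flow :
  (bc0 B + balpha B ^+ 2 / blambda B) * ip m (Omega B) e_p e_p
    + bK B * bdt B * ipM m (Omega B) (grad e_p) (grad e_p) =
  balpha B / blambda B * ip m (Omega B) (fun x => sxi Y x - sxi X x) e_p.
Proof.
have [_ pxi0 _] := hprev; have [[uX xiX pX] eqX] := hX.
have [[uZ xiZ pZ] eqZ _] := hZ.
have Mp : Mh B e_p by exact: MhB.
(* [coupled_step] quantifies over three test functions at once; components of [X] fill the other two
   slots. *)
have [_ _ ] := eqX _ _ _ uX xiX Mp; have := eqZ _ Mp.
have ppe := pp (proj1 Mp).
have ppX := pp (proj1 pX); have ppZ := pp (proj1 pZ).
have pxX := pp xiX; have px0 := pp pxi0.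
rewrite (ipM_gradBl UG bndO ppZ ppX ppe) (ipBl UG bndO ppZ ppX ppe).
rewrite (ipBl UG bndO pY px0 ppe) (ipBl UG bndO pY pxX ppe).
generalize_ip; move=> *; lra.
Qed.

(** Both algorithms share this equation, so the loads cancel; [e_u] is an admissible test since both
    displacements vanish on [Gamma_d]. *)
Lemma error_elasticity :
  2 * bmu B * ipM m (Omega B) (strain e_u) (strain e_u) =
  ip m (Omega B) e_xi (div e_u).
Proof.
have [[uX xiX pX] eqX] := hX; have [[uZ xiZ pZ] _ eqZ] := hZ.
have Vu : Vh B e_u by exact: VhB.
have [+ _ _] := eqX _ _ _ Vu xiX pX; have [+ _] := eqZ _ _ Vu xiX.
have ppe : piecewise_polyv U e_u by move=> i; exact: pp (proj1 Vu i).
have puX : piecewise_polyv U (su X) by move=> i; exact: pp (proj1 uX i).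
have puZ : piecewise_polyv U (su Z) by move=> i; exact: pp (proj1 uZ i).
have pxX := pp xiX; have pxZ := pp xiZ.
rewrite (ipM_strainBl UG bndO puZ puX ppe).
rewrite (ipBl UG bndO pxZ pxX (piecewise_poly_div UG ppe)).
generalize_ip; move=> *; lra.
Qed.

Lemma error_pressure :
  ip m (Omega B) e_xi (div e_u) + 1 / blambda B * ip m (Omega B) e_xi e_xi =
  balpha B / blambda B * ip m (Omega B) e_p e_xi.
Proof.
have [[uX xiX pX] eqX] := hX; have [[uZ xiZ pZ] _ eqZ] := hZ.
have We : Wh B e_xi by exact: Pk_feB.
have [_ + _] := eqX _ _ _ uX We pX; have [_ +] := eqZ _ _ uX We.
have puX : piecewise_polyv U (su X) by move=> i; exact: pp (proj1 uX i).
have puZ : piecewise_polyv U (su Z) by move=> i; exact: pp (proj1 uZ i).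
have ppe := pp We; have ppX := pp (proj1 pX); have ppZ := pp (proj1 pZ).
have pxX := pp xiX; have pxZ := pp xiZ.
rewrite (ipC _ e_xi (div e_u)) (ip_divBl UG bndO puZ puX ppe) (ipBl UG bndO pxZ pxX ppe).
rewrite (ipBl UG bndO ppZ ppX ppe).
generalize_ip; move=> *; lra.
Qed.

Lemma error_p_le : L2norm m (Omega B) e_p <=
  (balpha B / blambda B) / (bc0 B + balpha B ^+ 2 / blambda B) *
  L2norm m (Omega B) (fun x => sxi Y x - sxi X x).
Proof.
have [[_ xiX pX] _] := hX; have [[_ _ pZ] _ _] := hZ.
apply: (L2norm_le_of_ip UG bndO).
- exact: piecewise_polyB pY (pp xiX).
- exact: pp (proj1 (MhB pZ pX)).
(* The coefficient stays positive for [c0 = 0] thanks to [alpha^2 / lambda]. *)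
- have := alpha_gt0 hB; have := lambda_gt0 hB; have := c0_ge0 hB => c0 l0 a0.
  by rewrite ltr_wpDl// divr_gt0// exprn_gt0.
- by rewrite divr_ge0// ltW// ?(alpha_gt0 hB) ?(lambda_gt0 hB).
- rewrite -error_flow lerDl mulr_ge0 ?ipM_ge0//.
  by rewrite mulr_ge0// ltW// ?(K_gt0 hB) ?(dt_gt0 hB).
Qed.

Lemma error_xi_le :
  L2norm m (Omega B) e_xi <= balpha B * L2norm m (Omega B) e_p.
Proof.
have [[_ xiX pX] _] := hX; have [[_ xiZ pZ] _ _] := hZ.
have l0 := lambda_gt0 hB; have a0 := alpha_gt0 hB; have u0 := mu_gt0 hB.
(* Puts [alpha] in the form [k / a] with [k = alpha / lambda] and [a = 1 / lambda], the coefficients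
   of [error_pressure]. *)
have -> : balpha B = (balpha B / blambda B) / (1 / blambda B).
  by field; rewrite gt_eqF.
apply: (L2norm_le_of_ip UG bndO).
- exact: pp (proj1 (MhB pZ pX)).
- exact: pp (Pk_feB xiZ xiX).
- by rewrite divr_gt0.
- by rewrite divr_ge0// ltW.
- rewrite -error_pressure -error_elasticity lerDr.
  by rewrite mulr_ge0 ?ipM_ge0// mulr_ge0// ltW.
Qed.

Lemma error_strain_le :
  L2normM m (Omega B) (strain e_u) <=
  Num.sqrt d%:R / (2 * bmu B) * L2norm m (Omega B) e_xi.
Proof.
have [[uX xiX _] _] := hX; have [[uZ xiZ _] _ _] := hZ.
apply: (L2normM_strain_le UG bndO).
- by move=> i; exact: pp (proj1 (VhB uZ uX) i).
- exact: pp (Pk_feB xiZ xiX).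
- exact: mu_gt0 hB.
- by rewrite error_elasticity.
Qed.

End error_equations.

(** * Contraction of the iteration *)

Theorem theorem4p2 (R : realType) (d : nat) (B : biot_data R d)
  (hB : biot_setting B) (n : nat) (hn : (1 <= n)%N)
  (X Y : nat -> state R d)
  (hprev : in_spaces B (X n.-1))
  (hX : coupled_step B (X n.-1) (X n))
  (hY : decoupled_iterates B (X n.-1) Y) :
  let C := (balpha B ^+ 2 / blambda B) / (bc0 B + balpha B ^+ 2 / blambda B) in
  let e_u i := fun x => su (Y i) x - su (X n) x in
  let e_xi i := fun x => sxi (Y i) x - sxi (X n) x in
  let e_p i := fun x => sp (Y i) x - sp (X n) x in
  let norm := L2norm (lebesgue_rV R d) (Omega B) in
  let normM := @L2normM R d (lebesgue_rV R d) (Omega B) d d in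
  (0 < C /\ C <= 1) /\
  (forall i : nat, (1 <= i)%N ->
    [/\ norm (e_xi i) <= C * norm (e_xi i.-1),
        norm (e_p i) <= C / balpha B * norm (e_xi i.-1) &
        normM (strain (e_u i)) <=
          Num.sqrt d%:R / (2 * bmu B) * norm (e_xi i)]).
Proof.
move=> C e_u e_xi e_p norm normM.
have [c0 l0 a0] := And3 (c0_ge0 hB) (lambda_gt0 hB) (alpha_gt0 hB).
have al0 : 0 < balpha B ^+ 2 / blambda B by rewrite divr_gt0// exprn_gt0.
have den0 : 0 < bc0 B + balpha B ^+ 2 / blambda B by rewrite ltr_wpDl.
split.
  by split; [rewrite divr_gt0|rewrite ler_pdivrMr// mul1r lerDr].
have [U UG] := cell_interiors_exist (Omega_regular hB) (Th_triangulates hB).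
have [Y0 stepY] := hY.
(* The initial iterate is only specified on the closure of the domain. *)
have pY i : piecewise_poly U (sxi (Y i)).
  case: i => [|i]; last first.
    by have [[_ xiY _] _ _] := stepY i.+1 isT; exact: Pk_fe_piecewise_poly UG xiY.
  have [_ xi0 _] := hprev.
  move=> S ST; have [q pq] := Pk_fe_piecewise_poly UG xi0 ST.
  exists q => x Ux; rewrite -pq//.
  by have [|] := Y0 x; first exact/subset_closure/(ci_sub UG ST).
move=> i i1; have step := stepY i i1.
(* One power of [alpha] cancels, giving the constant of [error_p_le]. *)
have CE : C / balpha B = (balpha B / blambda B) /
    (bc0 B + balpha B ^+ 2 / blambda B).
  rewrite /C; field; rewrite !gt_eqF//.
  by rewrite ltr_wpDl ?exprn_gt0// mulr_ge0// ltW.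
have ple : norm (e_p i) <= C / balpha B * norm (e_xi i.-1).
  by rewrite CE; exact: (error_p_le hB hprev hX step UG (pY i.-1)).
split=> //; last exact: (error_strain_le hB hX step UG).
(* The factor [alpha] from [error_xi_le] cancels the division by [alpha] in the pressure bound,
   leaving exactly [C]. *)
apply: le_trans (error_xi_le hB hX step UG) _.
apply: le_trans (ler_wpM2l (ltW a0) ple) _.
by rewrite mulrA mulrCA divff ?mulr1// gt_eqF.
Qed.
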